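(* Let $G$ be a connected graph and let $H$ be a connected bipartite graph with at least one edge. Then B wins the gp achievement game on $G\,\square\,H$ after his first move.
   Context: A general position set of a graph $G$ is a set $S\subseteq V(G)$ such that no three vertices of $S$ lie on a common shortest path of $G$. The gp achievement game on a graph: players A and B alternately select vertices, A first; a selection is legal if the vertex has not been selected before and the set of all vertices selected so far (including it) is a general position set. The game ends when no legal move exists, and the player who selected the last vertex wins; ''a player wins the game'' means that player has a winning strategy. The Cartesian product $G\,\square\,H$ has vertex set $V(G)\times V(H)$, with $(g_1,h_1)$ adjacent to $(g_2,h_2)$ iff either $g_1g_2\in E(G)$ and $h_1=h_2$, or $g_1=g_2$ and $h_1h_2\in E(H)$. *)

(* Defs.v *)
From mathcomp Require Import all_boot.

Set Implicit Arguments.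
Unset Strict Implicit.
Unset Printing Implicit Defensive.

(* Simple graphs, possibly infinite. *)
Record graph := Graph {
  vertex :> eqType;
  adj : rel vertex;
  adj_sym : symmetric adj;
  adj_irrefl : irreflexive adj
}.
Arguments adj : clear implicits.

Section Graphs.
Variable G : graph.

(* The null graph is not connected. *)
Definition connected_graph : Prop :=
  inhabited G /\
  forall x y : G, exists2 p : seq G, path (adj G) x p & last x p = y.

Definition bipartite : Prop :=
  exists c : G -> bool, forall x y : G, adj G x y -> c x != c y.

Definition has_edge : Prop := exists x y : G, adj G x y.

(* The path with vertices x :: p; its length is size p. *)
Definition shortest_path (x : G) (p : seq G) : Prop :=
  path (adj G) x p /\
  forall q : seq G,
    path (adj G) x q -> last x q = last x p -> size p <= size q.

Definition on_common_shortest_path (a b c : G) : Prop :=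
  exists (x : G) (p : seq G),
    shortest_path x p /\ [/\ a \in x :: p, b \in x :: p & c \in x :: p].

Definition general_position (S : {pred G}) : Prop :=
  forall a b c : G, a \in S -> b \in S -> c \in S ->
    a != b -> a != c -> b != c -> ~ on_common_shortest_path a b c.

End Graphs.

Section CartesianProduct.
Variables G H : graph.

Definition cart_adj : rel (G * H)%type := fun u v =>
  (adj G u.1 v.1 && (u.2 == v.2)) || ((u.1 == v.1) && adj H u.2 v.2).

Lemma cart_adj_sym : symmetric cart_adj.
Proof.
move=> u v; rewrite /cart_adj adj_sym (eq_sym u.2) (eq_sym u.1).
by rewrite (adj_sym u.2).
Qed.

Lemma cart_adj_irrefl : irreflexive cart_adj.
Proof. by move=> u; rewrite /cart_adj !adj_irrefl andbF. Qed.

Definition cart_prod : graph := Graph cart_adj_sym cart_adj_irrefl.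

End CartesianProduct.

Inductive player := PlayerA | PlayerB.

Section Game.
Variable G : graph.

(* A position of the game is the sequence of the vertices selected so far, in
   order of selection. *)
Definition to_move (s : seq G) : player :=
  if odd (size s) then PlayerB else PlayerA.

Definition legal_move (s : seq G) (v : G) : Prop :=
  v \notin s /\ general_position [in rcons s v].

Definition game_over (s : seq G) : Prop := ~ exists v : G, legal_move s v.

Definition selected_last (P : player) (s : seq G) : Prop :=
  exists (s' : seq G) (v : G), s = rcons s' v /\ to_move s' = P.

Definition strategy := seq G -> G.

(* The positions reachable when P follows sigma and the opponent makes
   arbitrary legal moves. *)
Inductive play_following (P : player) (sigma : strategy) : seq G -> Prop :=
| play_start : play_following P sigma [::]
| play_own s : play_following P sigma s -> to_move s = P ->
    legal_move s (sigma s) -> play_following P sigma (rcons s (sigma s))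
| play_opponent s v : play_following P sigma s -> to_move s <> P ->
    legal_move s v -> play_following P sigma (rcons s v).

(* The second condition, that every play ends, is automatic on a finite graph. *)
Definition winning_strategy (P : player) (sigma : strategy) : Prop :=
  [/\ forall s, play_following P sigma s -> to_move s = P ->
        ~ game_over s -> legal_move s (sigma s),
      forall u : nat -> G, exists n, ~ play_following P sigma (mkseq u n)
    & forall s, play_following P sigma s -> game_over s -> selected_last P s].

(* B has a winning strategy under which the play is over exactly when two
   vertices are selected: the first one of A and the first one of B. *)
Definition B_wins_after_first_move : Prop :=
  exists sigma : strategy,
    winning_strategy PlayerB sigma /\
    forall s, play_following PlayerB sigma s -> (game_over s <-> size s = 2).

End Game.

(* Main.v *)
Require Import Defs.
From Stdlib Require Import Classical ClassicalEpsilon.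
From mathcomp Require Import all_boot.

(** B answers A's first vertex [(g, h)] with [(g, h')], where [h'] is a neighbour
    of [h] in [H].  The distances of a vertex [w] to [(g, h)] and [(g, h')] differ:
    split two equally long shortest paths to [w] into their [G]- and [H]-parts.
    The [G]-parts may be exchanged, so by minimality they have the same length,
    hence so have the [H]-parts, which contradicts the bipartiteness of [H].
    So a shortest path to [w] from the nearer of the two vertices, extended by the
    edge between them, is a shortest path through all three: no third vertex can
    ever be selected. *)

Set Implicit Arguments.
Unset Strict Implicit.
Unset Printing Implicit Defensive.

Section Walks.
Variable G : graph.

(** Descent on the length of [p]. Graphs may be infinite, so whether a shorter walk exists is
    settled by excluded middle. *)
Lemma exists_shortest_path (x : G) (p : seq G) : path (adj G) x p ->
  exists2 q, shortest_path x q & last x q = last x p.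
Proof.
have [n] := ubnP (size p); elim: n p => // n IHn p /ltnSE le_pn xp.
have [[q [xq lq lt_qp]]|p_min] := classic
  (exists q, [/\ path (adj G) x q, last x q = last x p & size q < size p]).
  have [r r_short lr] := IHn q (leq_trans lt_qp le_pn) xq.
  by exists r; rewrite // lr.
exists p => //; split=> // q xq lq; rewrite leqNgt; apply/negP=> lt_qp.
by apply: p_min; exists q.
Qed.

(** The walk [y :: p] is no longer than [q], which already attains the distance. *)
Lemma shortest_path_cons (x y : G) (p q : seq G) :
  adj G x y -> shortest_path y p -> shortest_path x q ->
  last y p = last x q -> size p < size q -> shortest_path x (y :: p).
Proof.
move=> xy [yp _] [_ q_min] lpq lt_pq; split=> [|r xr lr]; first by rewrite /= xy.
by apply: leq_trans lt_pq (q_min r xr _); rewrite lr.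
Qed.

Lemma bipartite_path_last (c : G -> bool) (x : G) (p : seq G) :
  (forall y z, adj G y z -> c y != c z) -> path (adj G) x p ->
  c (last x p) = c x (+) odd (size p).
Proof.
move=> c_adj; elim: p x => [|y p IHp] x /=; first by rewrite addbF.
case/andP=> xy /IHp ->; move: (c_adj _ _ xy).
by case: (c x) (c y) (odd _) => [] [] [].
Qed.

Lemma connected_neighbor (x : G) :
  connected_graph G -> has_edge G -> exists y, adj G x y.
Proof.
move=> [_ conG] [y [z yz]]; have [[|t p] /= xp lp] := conG x y.
  (* An empty walk means that [x] is itself the endpoint [y] of the given edge. *)
  by exists z; rewrite lp.
by exists t; case/andP: xp.
Qed.

Lemma on_common_shortest_path_swap (a b c : G) :
  on_common_shortest_path a b c -> on_common_shortest_path b a c.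
Proof. by move=> [x [p [p_short [ap bp cp]]]]; exists x, p. Qed.

Lemma nearer_on_common_shortest_path (x y : G) (p q : seq G) :
  adj G x y -> shortest_path y p -> shortest_path x q ->
  last y p = last x q -> size p < size q ->
  on_common_shortest_path x y (last y p).
Proof.
move=> xy yp xq lpq lt_pq; exists x, (y :: p).
split; first exact: shortest_path_cons xq lpq lt_pq.
by rewrite !inE !eqxx ?orbT; split=> //; rewrite -in_cons mem_last orbT.
Qed.

Lemma general_position_pair (x y : G) : general_position [in [:: x; y]].
Proof.
move=> a b c; rewrite !inE.
by move=> /orP[]/eqP-> /orP[]/eqP-> /orP[]/eqP->; rewrite ?eqxx.
Qed.

Lemma general_position_single (x : G) : general_position [in [:: x]].
Proof. by move=> a b c; rewrite !inE => /eqP-> /eqP->; rewrite eqxx. Qed.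

End Walks.

Section ProductWalks.
Variables G H : graph.

(** Each edge of the product moves in a single factor, so each step of [p] is assigned to exactly
    one of the two projections. *)
Lemma cart_path_split (u : cart_prod G H) (p : seq (cart_prod G H)) :
  path (adj (cart_prod G H)) u p ->
  exists p1 p2,
    [/\ path (adj G) u.1 p1, path (adj H) u.2 p2,
        last u.1 p1 = (last u p).1, last u.2 p2 = (last u p).2
      & size p = size p1 + size p2].
Proof.
elim: p u => [|v p IHp] u /=; first by exists [::], [::].
case/andP=> uv /IHp[p1 [p2 [vp1 vp2 l1 l2 ->]]].
case/orP: uv => /andP[].
  by move=> uv /eqP->; exists (v.1 :: p1), p2; rewrite /= uv.
by move=> /eqP-> uv; exists p1, (v.2 :: p2); rewrite /= uv addnS.
Qed.

(** The walk first follows [p1] with [h] fixed, then [p2] with the end of [p1] fixed. *)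
Lemma cart_path_join (g : G) (h : H) (p1 : seq G) (p2 : seq H) :
  path (adj G) g p1 -> path (adj H) h p2 ->
  exists p : seq (cart_prod G H),
    [/\ path (adj (cart_prod G H)) (g, h) p,
        last (g, h) p = (last g p1, last h p2) & size p = size p1 + size p2].
Proof.
elim: p1 g => [|g' p1 IHp] g /=.
  move=> _; elim: p2 h => [|h' p2 IHp] h /=; first by exists [::].
  case/andP=> hh' /IHp[p [h'p lp sp]]; exists ((g, h') :: p).
  by rewrite /= sp; split=> //; rewrite h'p andbT /cart_adj /= eqxx hh' orbT.
case/andP=> gg' g'p1 /(IHp g' g'p1)[p [g'p lp sp]]; exists ((g', h) :: p).
by rewrite /= sp; split=> //; rewrite g'p andbT /cart_adj /= eqxx gg'.
Qed.

Lemma cart_connected :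
  connected_graph G -> connected_graph H -> connected_graph (cart_prod G H).
Proof.
move=> [[g0] conG] [[h0] conH]; split; first exact: inhabits (g0, h0).
move=> [g h] [g' h']; have [p1 gp1 l1] := conG g g'.
have [p2 hp2 l2] := conH h h'; have [p [gp lp _]] := cart_path_join gp1 hp2.
by exists p; rewrite // lp l1 l2.
Qed.

(** Exchanging [p1] for [q1] and keeping [p2] gives another walk to [w], which cannot beat [p]. *)
Lemma shortest_path_split_le (g : G) (h : H) (w : cart_prod G H)
    (p : seq (cart_prod G H)) (p1 q1 : seq G) (p2 : seq H) :
  shortest_path ((g, h) : cart_prod G H) p -> last (g, h) p = w ->
  path (adj H) h p2 -> last h p2 = w.2 -> size p = size p1 + size p2 ->
  path (adj G) g q1 -> last g q1 = w.1 -> size p1 <= size q1.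
Proof.
move=> [_ p_min] lp hp2 l2 sp gq1 lq1.
have [r [gr lr sr]] := cart_path_join gq1 hp2.
rewrite -(leq_add2r (size p2)) -sp -sr; apply: p_min => //.
by rewrite lr lp lq1 l2 -surjective_pairing.
Qed.

Lemma shortest_path_size_neq (g : G) (h h' : H) (p q : seq (cart_prod G H)) :
  bipartite H -> adj H h h' ->
  shortest_path ((g, h) : cart_prod G H) p ->
  shortest_path ((g, h') : cart_prod G H) q ->
  last (g, h) p = last (g, h') q -> size p != size q.
Proof.
move=> [c c_adj] hh' p_short q_short lpq.
have [p1 [p2 [/= gp1 hp2 lp1 lp2 sp]]] := cart_path_split p_short.1.
have [q1 [q2 [/= gq1 hq2 lq1 lq2 sq]]] := cart_path_split q_short.1.
apply/eqP=> spq.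
rewrite -lpq in lq1 lq2.
have s1 : size p1 = size q1.
  apply/eqP; rewrite eqn_leq.
  rewrite (shortest_path_split_le p_short erefl hp2 lp2 sp gq1 lq1).
  by rewrite (shortest_path_split_le q_short (esym lpq) hq2 lq2 sq gp1 lp1).
have s2 : size p2 = size q2.
  by apply/eqP; rewrite -(eqn_add2l (size p1)) -sp {1}s1 -sq spq.
(* The [H]-parts end at the same vertex and have the same parity, so [h] and [h'] would get the same
   colour. *)
have := bipartite_path_last c_adj hp2; rewrite lp2 -lq2.
rewrite (bipartite_path_last c_adj hq2) s2 => /addIb ch.
by move: (c_adj _ _ hh'); rewrite ch eqxx.
Qed.

Lemma edge_on_common_shortest_path (g : G) (h h' : H) (w : cart_prod G H) :
  connected_graph G -> connected_graph H -> bipartite H -> adj H h h' ->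
  on_common_shortest_path ((g, h) : cart_prod G H) (g, h') w.
Proof.
move=> conG conH bipH hh'; have [_ conGH] := cart_connected conG conH.
have [p0 /exists_shortest_path[p p_short <-] <-] := conGH (g, h) w.
have [q0 /exists_shortest_path[q q_short <-] lqp] := conGH (g, h') (last (g, h) p).
have gh_adj : adj (cart_prod G H) (g, h) (g, h').
  by rewrite /= /cart_adj /= eqxx hh' orbT.
have := shortest_path_size_neq bipH hh' p_short q_short (esym lqp).
rewrite neq_ltn => /orP[lt_pq|lt_qp].
  (* Here [(g, h)] is nearer to [w], so the extended path starts at [(g, h')]. *)
  apply: on_common_shortest_path_swap.
  by apply: (nearer_on_common_shortest_path _ p_short q_short); rewrite // adj_sym.
by rewrite -lqp; apply: nearer_on_common_shortest_path lt_qp.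
Qed.

End ProductWalks.

Section Game.
Variable G : graph.

Lemma B_wins_by_blocking_reply :
  inhabited G ->
  (forall x : G, exists y : G,
     x != y /\ forall w, on_common_shortest_path x y w) ->
  B_wins_after_first_move G.
Proof.
move=> [x0] reply.
(* A strategy is a function, so the replies are chosen by indefinite description. *)
pose f x := sval (constructive_indefinite_description _ (reply x)).
have fP x : x != f x /\ forall w, on_common_shortest_path x (f x) w.
  by rewrite /f; case: constructive_indefinite_description.
(* The default [x0] is harmless: on the empty position it is A who moves. *)
pose sigma (s : seq G) := f (head x0 s).
have legal0 x : legal_move [::] x by split=> //; apply: general_position_single.
have legal1 x : legal_move [:: x] (f x).
  split; last exact: general_position_pair.
  by rewrite inE eq_sym; case: (fP x).
have over2 x : game_over [:: x; f x].
  case=> w [w_new w_gp]; have [neq_xfx fx_block] := fP x.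
  move: w_new; rewrite !inE negb_or => /andP[neq_wx neq_wfx].
  by apply: (w_gp x (f x) w) (fx_block w); rewrite ?inE ?eqxx ?orbT // eq_sym.
have reach s : play_following PlayerB sigma s ->
    [\/ s = [::], exists x, s = [:: x] | exists x, s = [:: x; f x]].
  elim=> {s} [|s _ [->|[x ->]|[x ->]] //|s v _ [->|[x ->]|[x ->]] //].
  - by constructor 1.
  - by constructor 3; exists x.
  - by constructor 2; exists v.
  - by move=> _ v_legal; case: (over2 x); exists v.
exists sigma; split; first split.
- move=> s /reach[->|[x ->]|[x ->]] // _ _; exact: legal1.
(* No reachable position has three vertices. *)
- move=> u; exists 3 => /reach[|[x]|[x]]; by [].
- move=> s /reach[->|[x ->]|[x ->]].
  + by case; exists x0; apply: legal0.
  + by case; exists (f x); apply: legal1.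
  + by move=> _; exists [:: x], (f x).
move=> s /reach[->|[x ->]|[x ->]]; split=> //.
- by case; exists x0; apply: legal0.
- by case; exists (f x); apply: legal1.
Qed.

End Game.

Theorem theorem3p5 (G H : graph) :
  connected_graph G -> connected_graph H -> bipartite H -> has_edge H ->
  B_wins_after_first_move (cart_prod G H).
Proof.
move=> conG conH bipH edgeH.
apply: B_wins_by_blocking_reply; first by case: (cart_connected conG conH).
move=> [g h]; have [h' hh'] := connected_neighbor h conH edgeH.
exists (g, h'); split; last by move=> w; apply: edge_on_common_shortest_path.
by apply: contraTneq hh' => -[<-]; rewrite adj_irrefl.
Qed.
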